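(* Let $\Delta\ge 2$, $h\ge 1$, $\alpha\ge 2$, and consider the metric induced by a $\Delta$-ary $\alpha$-HST of height $h$, with all servers and requests located at leaves. Let $\mathbb{D}=\prod_{i=1}^n\mathbb{D}_i$ be any product of distributions over the leaves. Then $$\mathrm{cost}(\mathrm{RS};\mathbb{D},\mathbb{D}) \le 6H_\Delta\sqrt{n}\sum_{j=0}^{h-1}\left(\frac{\sqrt{\Delta^{h-j}}}{\alpha^{h-j-1}}\sum_{\ell=0}^{j}\xi^{\ell}\right),\qquad \xi:=\frac{H_\Delta}{\alpha}.$$
   Context: A $\Delta$-ary $\alpha$-HST of height $h$ is a rooted tree in which every internal node has exactly $\Delta$ children, all leaves are at depth $h$, each edge between a node at depth $k$ and a child at depth $k+1$ has length $\alpha^{-k}$ (so root edges have length $1$); the metric on nodes is the length of the tree path. Online metric matching: $n$ servers are known upfront; $n$ requests arrive one at a time and each must be immediately and irrevocably matched to an unmatched server, at cost equal to their distance. The Random-Subtree algorithm $\mathrm{RS}$: when request $r$ arrives (at a leaf), let $v$ be the lowest ancestor of $r$ (possibly $r$ itself) whose subtree contains an unmatched server; starting at $v$, repeatedly move to a child chosen uniformly at random among the children whose subtrees contain an unmatched server, until reaching a leaf, and match $r$ to an unmatched server at that leaf. $\mathrm{cost}(\mathrm{RS};S,R)$ is the expected total cost of RS for server set $S$ and request sequence $R$; $\mathrm{cost}(\mathrm{RS};\mathbb D,\mathbb D)=\mathbb{E}[\mathrm{cost}(\mathrm{RS};S,R)]$ where $S=\{s_1,\dots,s_n\}$ and $R=(r_1,\dots,r_n)$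 are independent, with $s_i,r_i\sim\mathbb D_i$, all draws independent, and requests arriving in the order $r_1,\dots,r_n$. $H_k=1+1/2+\dots+1/k$ is the $k$-th harmonic number. *)

(* Defs.v *)
(* MathComp world. *)
From HB Require Import structures.
From mathcomp Require Import all_boot all_order all_algebra.

Set Implicit Arguments.
Unset Strict Implicit.
Unset Printing Implicit Defensive.

Import Order.TTheory GRing.Theory Num.Theory.
Local Open Scope ring_scope.

(* A node of the Delta-ary tree of height h is the word of child indices
   leading to it from the root: [::] is the root, the depth is the size, the
   children of v are the rcons v c, the ancestors of v (v included) are its
   prefixes, and the leaves are the words of size h. *)
Notation node Delta := (seq 'I_Delta) (only parsing).
Notation leaf Delta h := (h.-tuple 'I_Delta) (only parsing).

Fixpoint lca (Delta : nat) (u v : node Delta) : node Delta :=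
  match u, v with
  | a :: u', b :: v' => if a == b then a :: lca u' v' else [::]
  | _, _ => [::]
  end.

(* An edge between depths k and k + 1 has length alpha^-k. *)
Definition descent_length (R : rcfType) (alpha : R) (k l : nat) : R :=
  \sum_(k <= i < l) alpha ^- i.

(* The tree path from u to v climbs from u to lca u v, then descends to v. *)
Definition hst_dist (R : rcfType) (Delta : nat) (alpha : R)
    (u v : node Delta) : R :=
  descent_length alpha (size (lca u v)) (size u) +
  descent_length alpha (size (lca u v)) (size v).

(* In the following definitions the sequence F is the multiset of the positions
   of the unmatched servers; several servers may share a leaf. *)

Definition has_server (Delta h : nat) (F : seq (leaf Delta h))
    (v : node Delta) : bool :=
  has (fun s : leaf Delta h => prefix v s) F.

Definition live_children (Delta h : nat) (F : seq (leaf Delta h))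
    (v : node Delta) : {set 'I_Delta} :=
  [set c | has_server F (rcons v c)].

(* Probability that the random descent from v is at x after k steps. *)
Fixpoint descent_prob (R : rcfType) (Delta h : nat) (F : seq (leaf Delta h))
    (k : nat) (v : node Delta) (x : leaf Delta h) : R :=
  if k is k'.+1 then
    \sum_(c in live_children F v)
      #|live_children F v|%:R^-1 * descent_prob R F k' (rcons v c) x
  else (v == x)%:R.

(* The maximum is over a nonempty set as soon as F is nonempty, the root being
   an ancestor of every leaf. *)
Definition start_depth (Delta h : nat) (F : seq (leaf Delta h))
    (r : leaf Delta h) : nat :=
  \max_(k < h.+1 | has_server F (take k r)) k.

Definition RS_prob (R : rcfType) (Delta h : nat) (F : seq (leaf Delta h))
    (r x : leaf Delta h) : R :=
  descent_prob R F (h - start_depth F r) (take (start_depth F r) r) x.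

(* Probability that, from the unmatched servers F, the successive requests rs
   are matched to servers at the successive leaves xs. *)
Fixpoint RS_run_prob (R : rcfType) (Delta h : nat) (F : seq (leaf Delta h))
    (rs xs : seq (leaf Delta h)) : R :=
  match rs, xs with
  | r :: rs', x :: xs' => RS_prob R F r x * RS_run_prob R (rem x F) rs' xs'
  | [::], [::] => 1
  | _, _ => 0
  end.

Definition RS_cost (R : rcfType) (Delta h n : nat) (alpha : R)
    (S Q : n.-tuple (leaf Delta h)) : R :=
  \sum_(X : n.-tuple (leaf Delta h))
    RS_run_prob R S Q X * \sum_(i < n) hst_dist alpha (tnth Q i) (tnth X i).

Definition is_distribution (R : rcfType) (T : finType) (p : T -> R) : Prop :=
  (forall x, 0 <= p x) /\ \sum_x p x = 1.

Definition product_distribution (R : rcfType) (T : finType) (n : nat)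
    (p : 'I_n -> T -> R) (t : n.-tuple T) : R :=
  \prod_(i < n) p i (tnth t i).

Definition RS_expected_cost (R : rcfType) (Delta h n : nat) (alpha : R)
    (p : 'I_n -> leaf Delta h -> R) : R :=
  \sum_(S : n.-tuple (leaf Delta h)) \sum_(Q : n.-tuple (leaf Delta h))
    product_distribution p S * product_distribution p Q * RS_cost alpha S Q.

Definition harmonic (R : rcfType) (k : nat) : R :=
  \sum_(1 <= i < k.+1) i%:R^-1.

(* Main.v *)
Require Import Defs.
From mathcomp Require Import all_boot all_order all_algebra.
From mathcomp Require Import zify ring lra.

Set Implicit Arguments.
Unset Strict Implicit.
Unset Printing Implicit Defensive.

Import Order.TTheory GRing.Theory Num.Theory.
Local Open Scope ring_scope.

(** A request started at depth d pays at most twice the edge lengths below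
    depth d, so the cost of RS is at most 2 * \sum_k alpha^-k * T_k, where T_k
    is the expected number of requests with start depth at most k. Each of
    these descends through exactly one node of depth k, picking a uniformly
    random live child there. Ranking the live children by the time at which
    they would run out of servers, a server stolen from the child of rank i
    displaces a later request when only i - 1 siblings are left; the expected
    number g l of descents in such a chain with l live children satisfies
    g l = 1 + (g 0 + ... + g (l - 1)) / l, that is, g l = H_l. Chains start
    either with a descent from above or with a request exceeding the number of
    servers in its own depth k + 1 subtree, hence
    T_k <= H_Delta * (T_(k-1) + total excess at depth k + 1). The expected excess
    is controlled by the variance of the number of points in each subtree,
    together with AM-GM over the subtrees. *)

(** * Harmonic numbers *)

Section Harmonic.
Variable R : rcfType.
Local Notation H := (harmonic R).

Lemma harmonic0 : H 0 = 0.
Proof. by rewrite /harmonic big_geq. Qed.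

Lemma harmonicS k : H k.+1 = H k + k.+1%:R^-1.
Proof. by rewrite /harmonic big_nat_recr. Qed.

Lemma harmonic_ge0 k : 0 <= H k.
Proof. by apply: sumr_ge0 => i _; rewrite invr_ge0 ler0n. Qed.

Lemma harmonic_le : {homo H : k l / (k <= l)%N >-> k <= l}.
Proof.
apply: homo_leq => [//|? ? ?|k]; first exact: le_trans.
by rewrite harmonicS lerDl invr_ge0 ler0n.
Qed.

Lemma harmonic_ge1 k : (0 < k)%N -> 1 <= H k.
Proof.
by move/harmonic_le; apply: le_trans; rewrite harmonicS harmonic0 add0r invr1.
Qed.

(** The recurrence g l = 1 + (g 0 + ... + g (l - 1)) / l of the chain length, solved by [H] and
    cleared of the division. *)
Lemma sum_harmonic k : \sum_(i < k) H i = k%:R * (H k - 1).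
Proof.
elim: k => [|k IHk]; first by rewrite big_ord0 mul0r.
rewrite big_ord_recr /= IHk harmonicS.
by rewrite -natr1; field; rewrite natr1 pnatr_eq0.
Qed.

End Harmonic.

(** * The potential of one level, on abstract edges (parent, child) *)

Section Potential.
Variables (R : rcfType) (V : finType) (C : finType).
Implicit Types (f : V * C -> nat) (us : seq (V * C)) (u w : V * C).

Definition take_server f u : V * C -> nat := fun w => (f w - (w == u))%N.

Definition live f (v : V) : {set C} := [set c | (0 < f (v, c))%N].

(* Expected number of future descents, read off the run in which no further
   descent takes place: there, a request u that finds no server below its own
   edge starts a chain of harmonic length in the number of live siblings. *)
Fixpoint potential f us : R :=
  if us is u :: us' then
    if (0 < f u)%N then potential (take_server f u) us'
    else harmonic R #|live f u.1| + potential f us'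
  else 0.

Lemma eq_live f g : f =1 g -> live f =1 live g.
Proof. by move=> fg v; apply/setP=> c; rewrite !inE fg. Qed.

Lemma eq_potential f g us : f =1 g -> potential f us = potential g us.
Proof.
elim: us f g => //= u us IHus f g fg; rewrite -fg (eq_live fg) (IHus _ _ fg).
by case: ifP => // _; apply: IHus => w; rewrite /take_server fg.
Qed.

Lemma potential_ge0 f us : 0 <= potential f us.
Proof.
by elim: us f => //= u us IHus f; case: ifP => // _; rewrite addr_ge0 ?harmonic_ge0.
Qed.

Lemma take_serverC f u w :
  take_server (take_server f u) w =1 take_server (take_server f w) u.
Proof. by move=> x; rewrite /take_server subnAC. Qed.

Lemma live_take_server_sub f u v : live (take_server f u) v \subset live f v.
Proof. by apply/subsetP=> c; rewrite !inE /take_server; lia. Qed.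

Lemma live_take_server_other f u v : u.1 != v -> live (take_server f u) v = live f v.
Proof.
move=> uv; apply/setP=> c; rewrite !inE /take_server.
have -> : ((v, c) == u) = false by apply: contraNF uv => /eqP <-.
by rewrite subn0.
Qed.

Lemma live_take_server_many f v c :
  (1 < f (v, c))%N -> live (take_server f (v, c)) v = live f v.
Proof.
move=> fvc; apply/setP=> d; rewrite !inE /take_server.
by case: eqP => [->|_]; lia.
Qed.

Lemma live_take_server_last f v c :
  f (v, c) = 1%N -> live (take_server f (v, c)) v = live f v :\ c.
Proof.
move=> fvc; apply/setP=> d; rewrite !inE /take_server xpair_eqE eqxx /=.
by case: eqP => [->|_]; [rewrite fvc | rewrite subn0].
Qed.

(** A stolen server matters only when its child would have run out: the request then displaced is
    charged H_i, with i the number of siblings still alive, and afterwards both runs coincide.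
    Distinct children have distinct i, and a child that never runs out contributes at most 0. *)
Lemma potential_jump f v us :
  \sum_(c in live f v) (potential (take_server f (v, c)) us - potential f us)
    <= \sum_(i < #|live f v|) harmonic R i.
Proof.
elim: us f => [|u us IHus] f /=.
  rewrite big1 ?sumr_ge0 // => [i _|c _]; [exact: harmonic_ge0 | exact: subrr].
have [fu_gt0|fu0] := ltnP 0 (f u); last first.
  (* Here [u] is charged in both runs; the theft can only shrink its live set, hence its charge. *)
  apply: le_trans (IHus f); apply: ler_sum => c; rewrite inE => fc.
  rewrite ifN; last by rewrite /take_server; lia.
  have := harmonic_le R (subset_leq_card (live_take_server_sub f (v, c) u.1)).
  lra.
have [uv|uv] := eqVneq u.1 v; last first.
  rewrite -(live_take_server_other f uv); apply: le_trans (IHus _).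
  rewrite le_eqVlt; apply/orP; left; apply/eqP; apply: eq_bigr => c _.
  have -> : take_server f (v, c) u = f u.
    rewrite /take_server; have -> : (u == (v, c)) = false.
      by apply: contraNF uv => /eqP ->.
    by rewrite subn0.
  by rewrite fu_gt0 (eq_potential us (take_serverC f (v, c) u)).
case: u uv fu_gt0 => _ c /= -> fc_gt0.
have [fc_gt1|fc_le1] := ltnP 1 (f (v, c)).
  rewrite -(live_take_server_many fc_gt1); apply: le_trans (IHus _).
  rewrite le_eqVlt; apply/orP; left; apply/eqP; apply: eq_bigr => d _.
  have -> : (0 < take_server f (v, d) (v, c))%N by rewrite /take_server; lia.
  by rewrite (eq_potential us (take_serverC f (v, d) (v, c))).
have fc1 : f (v, c) = 1%N by lia.
have c_live : c \in live f v by rewrite inE.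
have cardE : #|live f v| = #|live f v :\ c|.+1.
  by rewrite (cardsD1 c) c_live.
(* The request takes the last server of [c]: the summand of [c] is the top term on the right, and
   induction handles the other live children. *)
rewrite (bigD1 c) //= cardE big_ord_recr /= addrC lerD //; last first.
  rewrite ifN; last by rewrite /take_server eqxx; lia.
  by rewrite (live_take_server_last fc1) addrK.
rewrite -(live_take_server_last fc1); apply: le_trans (IHus _).
rewrite (live_take_server_last fc1) le_eqVlt; apply/orP; left; apply/eqP.
apply: eq_big => [d|d /andP[_ dc]]; first by rewrite !inE andbC.
have -> : take_server f (v, d) (v, c) = f (v, c).
  by rewrite /take_server xpair_eqE eqxx eq_sym (negPf dc) subn0.
by rewrite fc_gt0 (eq_potential us (take_serverC f (v, d) (v, c))).
Qed.

(** Each charge is at most harmonic in [#|C|], and the truncated subtraction counts the charged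
    requests of each edge. *)
Lemma potential_le_excess f us :
  potential f us <= harmonic R #|C| * \sum_u (count_mem u us - f u)%:R.
Proof.
elim: us f => [|u us IHus] f /=.
  by rewrite mulr_ge0 ?harmonic_ge0 ?sumr_ge0.
have [fu_gt0|fu0] := ltnP 0 (f u).
  apply: le_trans (IHus _) _; apply: ler_wpM2l; first exact: harmonic_ge0.
  apply: ler_sum => w _; rewrite ler_nat /take_server (eq_sym w).
  case: eqP => [<-|_]; last by rewrite subn0.
  move: (count _ _) fu_gt0 => k; move: (f u) => l; lia.
rewrite (bigD1 u) //= eqxx mulrDr.
have := IHus f; rewrite (bigD1 u) //= mulrDr => IH.
have -> : \sum_(w | w != u) ((u == w) + count_mem w us - f w)%:R =
          \sum_(w | w != u) (count_mem w us - f w)%:R :> R.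
  by apply: eq_bigr => w /negPf wu; rewrite eq_sym wu.
have -> : (1%N + count_mem u us - f u)%N = (count_mem u us - f u).+1.
  by move: fu0; rewrite leqn0 => /eqP ->; rewrite !subn0.
rewrite -natr1 mulrDr mulr1.
have := harmonic_le R (subset_leq_card (subsetT (live f u.1))).
rewrite cardsT; lra.
Qed.

End Potential.

(** * The random descent and its start depth *)

Section Descent.
Variables (R : rcfType) (Delta h : nat).
Local Notation leaf := (h.-tuple 'I_Delta).
Implicit Types (F rs : seq leaf) (v : seq 'I_Delta) (r x : leaf).

Lemma has_server_prefix F v w : prefix v w -> has_server F w -> has_server F v.
Proof.
by move=> vw; apply: sub_has => s; apply: prefix_trans.
Qed.

Lemma has_server_nil F : has_server F [::] = (F != [::]).
Proof. by case: F => // s F; rewrite /has_server /= prefix0s. Qed.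

Lemma live_children_neq0 F v :
  has_server F v -> (size v < h)%N -> live_children F v != set0.
Proof.
case/hasP=> s sF /prefixP[[|c t] sE] vh; apply/set0Pn.
  by have := size_tuple s; rewrite sE cats0 => vE; rewrite vE ltnn in vh.
exists c; rewrite inE; apply/hasP; exists s => //.
by apply/prefixP; exists t; rewrite sE cat_rcons.
Qed.

Lemma descent_prob_ge0 F k v x : 0 <= descent_prob R F k v x.
Proof.
elim: k v => [|k IHk] v /=; first exact: ler0n.
by apply: sumr_ge0 => c _; rewrite mulr_ge0 ?invr_ge0 ?ler0n.
Qed.

Lemma descent_prob_support F k v x : has_server F v -> (k + size v)%N = h ->
  descent_prob R F k v x != 0 -> (x \in F) && prefix v x.
Proof.
elim: k v => [|k IHk] v Fv vh /=.
  have [vx _|_] := eqVneq v x; last by rewrite eqxx.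
  rewrite vx prefix_refl andbT; case/hasP: Fv => s sF.
  rewrite prefixE (vh : size v = h) take_oversize ?size_tuple // vx => /eqP sx.
  by rewrite -(val_inj sx).
apply: contraNT => xv; apply/eqP/big1 => c; rewrite inE => Fc.
have [->|dp] := eqVneq (descent_prob R F k (rcons v c) x) 0; first by rewrite mulr0.
have vch : (k + size (rcons v c))%N = h by rewrite size_rcons addnS.
have /andP[xF vcx] := IHk _ Fc vch dp.
by rewrite xF (prefix_trans (prefix_rcons v c) vcx) in xv.
Qed.

Lemma sum_inv_card_le1 (T : finType) (A : {set T}) :
  \sum_(c in A) #|A|%:R^-1 <= 1 :> R.
Proof.
rewrite sumr_const -[leLHS]mulr_natl.
have [->|A0] := eqVneq (#|A|%:R : R) 0; first by rewrite mul0r ler01.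
by rewrite divff.
Qed.

Lemma descent_probM F k v (phi : leaf -> R) :
  \sum_x descent_prob R F k.+1 v x * phi x =
  \sum_(c in live_children F v) #|live_children F v|%:R^-1 *
    \sum_x descent_prob R F k (rcons v c) x * phi x.
Proof.
under eq_bigr do rewrite big_distrl.
rewrite exchange_big; apply: eq_bigr => c _.
by rewrite big_distrr; apply: eq_bigr => x _; rewrite /= mulrA.
Qed.

(** Mass is lost when the descent meets a node without live children or ends off depth [h]. *)
Lemma sum_descent_prob_le1 F k v : \sum_x descent_prob R F k v x <= 1.
Proof.
suff : \sum_x descent_prob R F k v x * 1 <= 1.
  by under eq_bigr do rewrite mulr1.
elim: k v => [|k IHk] v.
  under eq_bigr do rewrite mulr1.
  have [vh|vh] := boolP (size v == h); last first.
    rewrite big1 // => x _ /=; case: eqP => // vx.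
    by rewrite vx size_tuple eqxx in vh.
  rewrite (bigD1 (Tuple vh)) //= eqxx big1 ?addr0 // => x.
  by rewrite -val_eqE /= eq_sym => /negPf ->.
rewrite descent_probM; apply: le_trans (sum_inv_card_le1 (live_children F v)).
apply: ler_sum => c _; rewrite -[leRHS]mulr1.
by rewrite ler_wpM2l ?invr_ge0 ?ler0n.
Qed.

Lemma descent_mean_le F k v (phi : leaf -> R) B :
    has_server F v -> (k + size v)%N = h -> 0 <= B ->
    (forall x, x \in F -> prefix v x -> phi x <= B) ->
  \sum_x descent_prob R F k v x * phi x <= B.
Proof.
move=> Fv vh B0 phiB.
apply: (@le_trans _ _ (\sum_x descent_prob R F k v x * B)); last first.
  by rewrite -big_distrl /= ler_piMl ?sum_descent_prob_le1.
apply: ler_sum => x _.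
have [->|dp] := eqVneq (descent_prob R F k v x) 0; first by rewrite !mul0r.
have /andP[xF vx] := descent_prob_support Fv vh dp.
by rewrite ler_wpM2l ?descent_prob_ge0 ?phiB.
Qed.

Lemma start_depth_le F r : (start_depth F r <= h)%N.
Proof. by apply/bigmax_leqP => k _; rewrite -ltnS. Qed.

Lemma has_server_start_depth F r : F != [::] -> has_server F (take (start_depth F r) r).
Proof.
move=> F0; apply: (big_ind (fun d => has_server F (take d r))) => //.
  by rewrite take0 has_server_nil.
by move=> k l Fk Fl; rewrite /maxn; case: ifP.
Qed.

Lemma start_depth_ge F r k : (k <= h)%N -> has_server F (take k r) ->
  (k <= start_depth F r)%N.
Proof.
move=> kh Fk; rewrite -ltnS in kh.
exact: (@leq_bigmax_cond _ _ (fun i : 'I_h.+1 => i : nat) (Ordinal kh)).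
Qed.

Lemma size_take_start F r : size (take (start_depth F r) r) = start_depth F r.
Proof. by rewrite size_takel // size_tuple start_depth_le. Qed.

Lemma RS_mean_le F r (phi : leaf -> R) B : F != [::] -> 0 <= B ->
    (forall x, x \in F -> prefix (take (start_depth F r) r) x -> phi x <= B) ->
  \sum_x RS_prob R F r x * phi x <= B.
Proof.
move=> F0; apply: descent_mean_le; first exact: has_server_start_depth.
by rewrite size_take_start subnK ?start_depth_le.
Qed.

Lemma RS_prob_ge0 F r x : 0 <= RS_prob R F r x.
Proof. exact: descent_prob_ge0. Qed.

Lemma RS_prob_support F r x : F != [::] -> RS_prob R F r x != 0 ->
  (x \in F) && prefix (take (start_depth F r) r) x.
Proof.
move=> F0; apply: descent_prob_support; first exact: has_server_start_depth.
by rewrite size_take_start subnK ?start_depth_le.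
Qed.

(** * The potential along the run of RS, for the edges between depths j and j + 1 *)

Variable j : 'I_h.

(** Edges are encoded by upper end and child index, so that they form a finite type in which [live]
    groups siblings. *)
Definition edge_above x : j.-tuple 'I_Delta * 'I_Delta :=
  ([tuple tnth x (widen_ord (ltnW (ltn_ord j)) i) | i < j], tnth x j).

Lemma edge_above1 x : (edge_above x).1 = take j x :> seq _.
Proof.
have sz : size (take j x) = j by rewrite size_takel // size_tuple ltnW.
apply: (@eq_from_nth _ (tnth x j)); rewrite ?sz ?size_tuple // => i ij.
by rewrite nth_take // -[i]/(val (Ordinal ij)) -tnth_nth tnth_mktuple (tnth_nth (tnth x j)).
Qed.

Lemma prefix_edge (w : j.-tuple 'I_Delta) c x :
  prefix (rcons w c) x = (edge_above x == (w, c)).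
Proof.
rewrite prefixE size_rcons size_tuple (take_nth (tnth x j)) ?size_tuple //.
by rewrite eqseq_rcons xpair_eqE -edge_above1 -tnth_nth.
Qed.

Definition edge_servers F (u : j.-tuple 'I_Delta * 'I_Delta) : nat :=
  count_mem u (map edge_above F).

Lemma has_server_edge F (w : j.-tuple 'I_Delta) c :
  has_server F (rcons w c) = (0 < edge_servers F (w, c))%N.
Proof.
by rewrite /edge_servers count_map -has_count; apply: eq_has => x; rewrite prefix_edge.
Qed.

Lemma live_edge_servers F (w : j.-tuple 'I_Delta) :
  live (edge_servers F) w = live_children F w.
Proof. by apply/setP=> c; rewrite !inE has_server_edge. Qed.

Lemma edge_servers_rem F x : x \in F ->
  edge_servers (rem x F) =1 take_server (edge_servers F) (edge_above x).
Proof.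
move=> xF u; rewrite /take_server /edge_servers.
rewrite (permP (perm_map edge_above (perm_to_rem xF))) /= eq_sym.
by rewrite addnC addnK.
Qed.

Definition level_potential F rs : R :=
  potential R (edge_servers F) (map edge_above rs).

Lemma level_potential_ge0 F rs : 0 <= level_potential F rs.
Proof. exact: potential_ge0. Qed.

(** [potential_jump] averaged over the l live children: by [sum_harmonic] the mean increase is at
    most H_l - 1, so H_l also pays for the descent itself. *)
Lemma level_potential_jump F rs (w : j.-tuple 'I_Delta) : has_server F w ->
  \sum_x descent_prob R F (h - j) w x * level_potential (rem x F) rs
    <= harmonic R #|live_children F w| - 1 + level_potential F rs.
Proof.
move=> Fw; have jh := ltn_ord j.
rewrite -(subnSK jh) descent_probM -big_distrr /=.
have L0 : live_children F w != set0.
  by apply: live_children_neq0 => //; rewrite size_tuple.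
rewrite -card_gt0 -(ltr0n R) in L0.
rewrite ler_pdivrMl //.
apply: (@le_trans _ _ (\sum_(c in live_children F w)
    potential R (take_server (edge_servers F) (w, c)) (map edge_above rs))).
  apply: ler_sum => c; rewrite inE => Fc; apply: descent_mean_le => //.
  - by rewrite size_rcons size_tuple subnK.
  - exact: potential_ge0.
  move=> x xF; rewrite prefix_edge => /eqP <-.
  by rewrite /level_potential (eq_potential _ _ (edge_servers_rem xF)).
have := potential_jump R (edge_servers F) w (map edge_above rs).
rewrite live_edge_servers sum_harmonic sumrB sumr_const -[_ *+ _]mulr_natl.
rewrite lerBlDr -mulrDr; exact: le_trans.
Qed.

(** The descent reaches some node of depth [j], where [level_potential_jump] applies; bounding its
    live children by [Delta] makes the estimate independent of that node. *)
Lemma level_potential_descent F rs v : (size v <= j)%N -> has_server F v ->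
  \sum_x descent_prob R F (h - size v) v x * level_potential (rem x F) rs
    <= harmonic R Delta - 1 + level_potential F rs.
Proof.
move=> vj Fv; have D0 : 0 <= harmonic R Delta - 1 + level_potential F rs.
  have D_gt0 : (0 < Delta)%N.
    by case/hasP: Fv => s _ _; apply: leq_ltn_trans (ltn_ord (tnth s j)).
  by rewrite addr_ge0 ?level_potential_ge0 // subr_ge0 harmonic_ge1.
move: {2}(j - size v)%N (erefl (j - size v)%N) => d.
elim: d v vj Fv => [|d IHd] v vj Fv dE.
  have vE : size v == j by rewrite eqn_leq vj -subn_eq0 dE.
  have := @level_potential_jump F rs (Tuple vE) Fv.
  rewrite /= (eqP vE) => /le_trans; apply; rewrite lerD2r lerD2r.
  by apply: harmonic_le; rewrite -[leqRHS]card_ord max_card.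
have vh : (size v < h)%N by have := ltn_ord j; lia.
rewrite -(subnSK vh) descent_probM.
apply: (@le_trans _ _ (\sum_(c in live_children F v) #|live_children F v|%:R^-1 *
         (harmonic R Delta - 1 + level_potential F rs))).
  apply: ler_sum => c; rewrite inE => Fc; rewrite ler_wpM2l ?invr_ge0 ?ler0n //.
  by have := IHd (rcons v c); rewrite size_rcons; apply => //; lia.
by rewrite -big_distrl /= ler_piMl ?sum_inv_card_le1.
Qed.

(** Ties the test in [potential] to the algorithm: the uncharged requests are those starting
    strictly below depth [j]. *)
Lemma edge_server_start F r :
  (0 < edge_servers F (edge_above r))%N = (j < start_depth F r)%N.
Proof.
rewrite [edge_above r]surjective_pairing -has_server_edge edge_above1 /=.
have -> : rcons (take j r) (tnth r j) = take j.+1 r.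
  by rewrite (take_nth (tnth r j)) ?size_tuple // -tnth_nth.
apply/idP/idP => [|jd]; first exact: start_depth_ge.
have F0 : F != [::].
  by apply: contraTneq jd => ->; rewrite /start_depth big_pred0.
apply: has_server_prefix (has_server_start_depth r F0).
by rewrite -(subnKC jd) takeD prefix_prefix.
Qed.

(* A descent through depth j is charged harmonic R Delta when it comes from
   above, and is prepaid by the potential when it starts at depth j. *)
Lemma level_potential_step F r rs : F != [::] ->
  (start_depth F r <= j)%:R +
  \sum_x RS_prob R F r x * level_potential (rem x F) rs
    <= harmonic R Delta * (start_depth F r < j)%:R + level_potential F (r :: rs).
Proof.
move=> F0; rewrite /level_potential /= edge_server_start.
set d := start_depth F r; have Fd := has_server_start_depth r F0.
have [jd|dj] := ltnP j d.
  (* Start below [j]: the matched leaf lies under the same edge as [r], as the potential assumes. *)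
  rewrite ltnNge ltnW // mulr0 !add0r; apply: RS_mean_le => // [|x xF].
    exact: potential_ge0.
  rewrite -/d => dx; rewrite le_eqVlt; apply/orP; left; apply/eqP.
  rewrite (eq_potential _ _ (edge_servers_rem xF)).
  suff -> : edge_above x = edge_above r by [].
  apply/eqP; rewrite [edge_above r]surjective_pairing -prefix_edge edge_above1 /=.
  have -> : rcons (take j r) (tnth r j) = take j.+1 r.
    by rewrite (take_nth (tnth r j)) ?size_tuple // -tnth_nth.
  by apply: prefix_trans dx; rewrite -(subnKC jd) takeD prefix_prefix.
move: dj; rewrite leq_eqVlt => /orP[/eqP dj|dj].
  (* Start at [j]: the charge of [r] in the potential covers the descent. *)
  rewrite -/d dj in Fd; rewrite dj ltnn mulr0 add0r.
  have := @level_potential_jump F rs (edge_above r).1.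
  rewrite /RS_prob -/d live_edge_servers edge_above1 dj => /(_ Fd).
  by rewrite -lerBrDl [leRHS]addrAC.
(* Start above [j]: [harmonic R Delta] pays, and the charge of [r] is dropped as nonnegative. *)
rewrite dj mulr1.
have := @level_potential_descent F rs (take d r).
rewrite size_take_start => /(_ (ltnW dj) Fd).
rewrite -lerBrDl => /le_trans; apply.
by rewrite [leRHS]addrAC lerD2l lerDr harmonic_ge0.
Qed.

End Descent.

Lemma big_tuple_cons (R : nmodType) (T : finType) n (E : n.+1.-tuple T -> R) :
  \sum_t E t = \sum_x \sum_(t : n.-tuple T) E (cons_tuple x t).
Proof.
rewrite pair_big /= (reindex (fun p : T * n.-tuple T => cons_tuple p.1 p.2)) //=.
exists (fun t => (thead t, behead_tuple t)) => [[x t] _|t _] /=.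
  by congr pair; apply: val_inj.
by rewrite [RHS]tuple_eta; apply: val_inj.
Qed.

Lemma prefix_size_lca (Delta : nat) (w u v : seq 'I_Delta) :
  prefix w u -> prefix w v -> (size w <= size (lca u v))%N.
Proof.
elim: w u v => [|a w IHw] [|b u] [|c v] //= /andP[/eqP <- wu] /andP[/eqP <- wv].
by rewrite eqxx ltnS IHw.
Qed.

(** * From start depths to the cost of RS *)

Section Crossings.
Variables (R : rcfType) (Delta h : nat).
Local Notation leaf := (h.-tuple 'I_Delta).
Local Notation H := (harmonic R Delta).
Implicit Types (F rs : seq leaf) (r x : leaf).

(* This is T_(k-1) in the notation of the header. *)
Fixpoint crossings (k : nat) F rs : R :=
  if rs is r :: rs' then
    (start_depth F r < k)%:R + \sum_x RS_prob R F r x * crossings k (rem x F) rs'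
  else 0.

Lemma crossings_ge0 k F rs : 0 <= crossings k F rs.
Proof.
elim: rs F => //= r rs IHrs F; rewrite addr_ge0 ?ler0n ?sumr_ge0 // => x _.
by rewrite mulr_ge0 ?RS_prob_ge0.
Qed.

Lemma crossings0 F rs : crossings 0 F rs = 0.
Proof.
by elim: rs F => //= r rs IHrs F; rewrite add0r big1 // => x _; rewrite IHrs mulr0.
Qed.

Lemma RS_mean_mono F r (phi psi : leaf -> R) : F != [::] ->
    (forall x, x \in F -> prefix (take (start_depth F r) r) x -> phi x <= psi x) ->
  \sum_x RS_prob R F r x * phi x <= \sum_x RS_prob R F r x * psi x.
Proof.
move=> F0 le_phi; apply: ler_sum => x _.
have [->|p0] := eqVneq (RS_prob R F r x) 0; first by rewrite !mul0r.
have /andP[xF dx] := RS_prob_support F0 p0.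
by rewrite ler_wpM2l ?RS_prob_ge0 ?le_phi.
Qed.

(** [level_potential_step] telescopes along the run; the size hypothesis leaves an unmatched server
    for every request. *)
Lemma crossings_step (j : 'I_h) F rs : (size rs <= size F)%N ->
  crossings j.+1 F rs <= H * crossings j F rs + level_potential R j F rs.
Proof.
elim: rs F => [|r rs IHrs] F /= rsF.
  by rewrite mulr0 add0r level_potential_ge0.
have F0 : F != [::] by case: F rsF.
apply: (@le_trans _ _ ((start_depth F r <= j)%:R + \sum_x RS_prob R F r x *
    (H * crossings j (rem x F) rs + level_potential R j (rem x F) rs))).
  rewrite lerD2l; apply: RS_mean_mono => // x xF _; apply: IHrs.
  by rewrite size_rem // -ltnS (ltn_predK rsF).
under [in leLHS]eq_bigr do rewrite mulrDr mulrCA.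
rewrite big_split /= -big_distrr /= mulrDr.
have := level_potential_step R j r rs F0.
set a := \sum_x _; set b := \sum_x _; lra.
Qed.

Definition excess (i : 'I_h) F rs : R :=
  \sum_u (count_mem u (map (edge_above i) rs) - edge_servers F u)%:R.

Lemma crossings_le_excess k F rs : (k <= h)%N -> (size rs <= size F)%N ->
  crossings k F rs <= \sum_(i < h | (i < k)%N) H ^+ (k - i) * excess i F rs.
Proof.
move=> kh rsF; elim: k kh => [|k IHk] kh.
  by rewrite crossings0 big_pred0.
pose j : 'I_h := Ordinal kh.
rewrite (bigD1 j) //= addrC subSnn expr1.
apply: le_trans (crossings_step j rsF) _; apply: lerD; last first.
  have := potential_le_excess R (@edge_servers _ _ j F) (map (edge_above j) rs).
  by rewrite card_ord.
apply: le_trans (ler_wpM2l (harmonic_ge0 _ _) (IHk (ltnW kh))) _.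
rewrite big_distrr le_eqVlt; apply/orP; left; apply/eqP.
apply: eq_big => [i|i ik]; first by rewrite ltnS ltn_neqAle andbC -val_eqE.
by rewrite /= mulrA -exprS subSn // ltnW.
Qed.

Variables (alpha : R) (alpha_gt0 : 0 < alpha).

(** Both leaves lie below a common ancestor of depth at least [d], so the climb and the descent each
    use only edges from depth [d] on. *)
Lemma hst_dist_le_start d r x : (d <= h)%N -> prefix (take d r) x ->
  hst_dist alpha r x <= 2 * \sum_(k < h) alpha ^- k * (d <= k)%:R.
Proof.
move=> dh dx; rewrite /hst_dist !size_tuple mulr_natl mulr2n.
have dl : (d <= size (lca r x))%N.
  have := prefix_size_lca (prefix_take r d) dx.
  by rewrite size_takel ?size_tuple.
suff len_le : descent_length alpha (size (lca r x)) h <=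
    \sum_(k < h) alpha ^- k * (d <= k)%:R by exact: lerD.
rewrite /descent_length big_geq_mkord big_mkcond /=.
apply: ler_sum => k _; have a0 : 0 <= alpha ^- k by rewrite invr_ge0 exprn_ge0 ?ltW.
case: ifP => [lk|_]; last by rewrite mulr_ge0 ?ler0n.
by rewrite (leq_trans dl lk) mulr1.
Qed.

Lemma hst_dist_ge0 r x : 0 <= hst_dist alpha r x.
Proof.
by rewrite addr_ge0 ?sumr_ge0 // => i _; rewrite invr_ge0 exprn_ge0 ?ltW.
Qed.

Lemma sum_RS_run_prob_le1 n F (Q : n.-tuple leaf) : (n <= size F)%N ->
  \sum_(X : n.-tuple leaf) RS_run_prob R F Q X <= 1.
Proof.
elim: n F Q => [|n IHn] F Q nF.
  rewrite (tuple0 Q) (big_pred1 [tuple]) //= => X.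
  by rewrite [X]tuple0; apply/esym/eqP.
have F0 : F != [::] by case: F nF.
case/tupleP: Q => r Q; rewrite big_tuple_cons /=.
under eq_bigr do rewrite -big_distrr /=.
apply: RS_mean_le => // x xF _; apply: IHn.
by rewrite size_rem // -ltnS (ltn_predK nF).
Qed.

(** Linearity of expectation over the edge levels: an edge from depth k to k + 1 is paid for only by
    requests of start depth at most k, the ones counted by [crossings k.+1]. *)
Lemma run_cost_le_crossings n F (Q : n.-tuple leaf) : (n <= size F)%N ->
  \sum_(X : n.-tuple leaf) RS_run_prob R F Q X *
      \sum_(i < n) hst_dist alpha (tnth Q i) (tnth X i)
    <= 2 * \sum_(k < h) alpha ^- k * crossings k.+1 F Q.
Proof.
elim: n F Q => [|n IHn] F Q nF.
  rewrite big1 => [|X _]; last by rewrite big_ord0 mulr0.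
  rewrite mulr_ge0 ?ler0n ?sumr_ge0 // => k _.
  by rewrite mulr_ge0 ?crossings_ge0 // invr_ge0 exprn_ge0 ?ltW.
have F0 : F != [::] by case: F nF.
case/tupleP: Q => r Q; rewrite big_tuple_cons /=.
apply: (@le_trans _ _ (\sum_x RS_prob R F r x * (hst_dist alpha r x +
    2 * \sum_(k < h) alpha ^- k * crossings k.+1 (rem x F) Q))).
  under eq_bigr => x _.
    under eq_bigr => X _.
      rewrite big_ord_recl !tnth0 -mulrA.
      under eq_bigr do rewrite !tnthS.
      over.
    rewrite -big_distrr /=.
    over.
  apply: RS_mean_mono => // x xF _.
  have remF : (n <= size (rem x F))%N by rewrite size_rem // -ltnS (ltn_predK nF).
  under eq_bigr do rewrite mulrDr.
  rewrite big_split /= -big_distrl /= lerD ?IHn //.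
  by rewrite ler_piMl ?hst_dist_ge0 ?sum_RS_run_prob_le1.
under [in leRHS]eq_bigr do rewrite mulrDr.
rewrite [in leRHS]big_split /=.
under [in leLHS]eq_bigr do rewrite mulrDr.
rewrite [in leLHS]big_split /= mulrDr; apply: lerD.
  apply: RS_mean_le => // [|x xF]; last exact: hst_dist_le_start (start_depth_le _ _).
  rewrite mulr_ge0 ?ler0n ?sumr_ge0 // => k _.
  by rewrite mulr_ge0 ?ler0n // invr_ge0 exprn_ge0 ?ltW.
rewrite le_eqVlt; apply/orP; left; apply/eqP.
under eq_bigr do rewrite mulrCA big_distrr.
rewrite -big_distrr exchange_big /=; congr (_ * _); apply: eq_bigr => k _.
by rewrite big_distrr; apply: eq_bigr => x _; rewrite mulrCA.
Qed.

Lemma RS_cost_le_excess n (S Q : n.-tuple leaf) :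
  RS_cost alpha S Q <= 2 * \sum_(k < h) \sum_(i < h | (i <= k)%N)
    alpha ^- k * H ^+ (k.+1 - i) * excess i S Q.
Proof.
apply: le_trans (run_cost_le_crossings _ _) _; first by rewrite size_tuple.
rewrite ler_wpM2l ?ler0n //; apply: ler_sum => k _.
under [leRHS]eq_bigr do rewrite -mulrA.
rewrite -big_distrr ler_wpM2l ?invr_ge0 ?exprn_ge0 ?(ltW alpha_gt0) //.
by apply: crossings_le_excess; rewrite ?size_tuple.
Qed.

End Crossings.

(** * Moments under a product distribution and the mean excess *)

Section ProductDistribution.
Variables (R : rcfType) (T : finType).

Lemma product_distribution_cons n (p : 'I_n.+1 -> T -> R) x (t : n.-tuple T) :
  product_distribution p (cons_tuple x t) =
  p ord0 x * product_distribution (fun i => p (lift ord0 i)) t.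
Proof.
rewrite /product_distribution big_ord_recl tnth0; congr (_ * _).
by apply: eq_bigr => i _; rewrite tnthS.
Qed.

Lemma product_distribution_ge0 n (p : 'I_n -> T -> R) t :
  (forall i, is_distribution (p i)) -> 0 <= product_distribution p t.
Proof. by move=> hp; apply: prodr_ge0 => i _; case: (hp i). Qed.

Lemma sum_product_distribution n (p : 'I_n -> T -> R) :
  (forall i, is_distribution (p i)) -> \sum_t product_distribution p t = 1.
Proof.
elim: n p => [|n IHn] p hp.
  rewrite (big_pred1 [tuple]) => [|t]; first by rewrite /product_distribution big_ord0.
  by rewrite [t]tuple0; apply/esym/eqP.
rewrite big_tuple_cons.
under eq_bigr => x _ do (under eq_bigr do rewrite product_distribution_cons;
  rewrite -big_distrr /= IHn // mulr1).
by case: (hp ord0).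
Qed.

Lemma mean_centered_sum n (p g : 'I_n -> T -> R) :
    (forall i, is_distribution (p i)) -> (forall i, \sum_x p i x * g i x = 0) ->
  \sum_t product_distribution p t * \sum_i g i (tnth t i) = 0.
Proof.
elim: n p g => [|n IHn] p g hp hg.
  by rewrite big1 // => t _; rewrite big_ord0 mulr0.
rewrite big_tuple_cons -[RHS](hg ord0); apply: eq_bigr => x _.
transitivity (\sum_(t : n.-tuple T) (p ord0 x * g ord0 x *
      product_distribution (fun i => p (lift ord0 i)) t +
    p ord0 x * (product_distribution (fun i => p (lift ord0 i)) t *
      \sum_i g (lift ord0 i) (tnth t i)))).
  apply: eq_bigr => t _; rewrite product_distribution_cons big_ord_recl tnth0.
  under eq_bigr do rewrite tnthS.
  ring.
rewrite big_split /= -!big_distrr /= (IHn _ (fun i => g (lift ord0 i))) //.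
by rewrite sum_product_distribution // mulr1 mulr0 addr0.
Qed.

(** By independence the cross terms of the square contain the mean of a centered sum and vanish. *)
Lemma second_moment_centered_sum n (p g : 'I_n -> T -> R) :
    (forall i, is_distribution (p i)) -> (forall i, \sum_x p i x * g i x = 0) ->
  \sum_t product_distribution p t * (\sum_i g i (tnth t i)) ^+ 2 =
  \sum_i \sum_x p i x * g i x ^+ 2.
Proof.
elim: n p g => [|n IHn] p g hp hg.
  rewrite big_ord0 big1 // => t _.
  by rewrite big_ord0 expr0n mulr0.
rewrite big_tuple_cons big_ord_recl /=.
transitivity (\sum_x (p ord0 x * g ord0 x ^+ 2 +
    p ord0 x * \sum_i \sum_y p (lift ord0 i) y * g (lift ord0 i) y ^+ 2)).
  apply: eq_bigr => x _.
  transitivity (\sum_(t : n.-tuple T) (p ord0 x * g ord0 x ^+ 2 *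
        product_distribution (fun i => p (lift ord0 i)) t +
      (2 * p ord0 x * g ord0 x * (product_distribution (fun i => p (lift ord0 i)) t *
        \sum_i g (lift ord0 i) (tnth t i)) +
      p ord0 x * (product_distribution (fun i => p (lift ord0 i)) t *
        (\sum_i g (lift ord0 i) (tnth t i)) ^+ 2)))).
    apply: eq_bigr => t _; rewrite product_distribution_cons big_ord_recl tnth0.
    under eq_bigr do rewrite tnthS.
    ring.
  rewrite !big_split /= -!big_distrr /= sum_product_distribution // mulr1.
  rewrite (mean_centered_sum (g := fun i => g (lift ord0 i))) // mulr0 add0r.
  by rewrite (IHn _ (fun i => g (lift ord0 i))).
by rewrite big_split /= -big_distrl /=; case: (hp ord0) => _ ->; rewrite mul1r.
Qed.

Variables (n : nat) (p : 'I_n -> T -> R) (hp : forall i, is_distribution (p i)).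
Variables (U : finType) (loc : T -> U).

(** The map [loc] cuts [T] into cells; it is later [edge_above i], whose cells are the subtrees
    rooted at depth i + 1. *)
Let q i u := \sum_x p i x * (loc x == u)%:R.
Let deviation u (t : n.-tuple T) := \sum_i ((loc (tnth t i) == u)%:R - q i u).

(** An indicator of mean q has variance q - q^2, at most q, and for each draw the q sum to 1 over
    the cells. *)
Lemma sum_variance_le :
  \sum_t product_distribution p t * \sum_u deviation u t ^+ 2 <= n%:R.
Proof.
under eq_bigr do rewrite big_distrr.
rewrite exchange_big /=.
apply: (@le_trans _ _ (\sum_u \sum_i q i u)).
  apply: ler_sum => u _.
  rewrite (second_moment_centered_sum (g := fun i x => (loc x == u)%:R - q i u)) //.
    apply: ler_sum => i _; have [p_ge0 p1] := hp i.
    have -> : \sum_x p i x * ((loc x == u)%:R - q i u) ^+ 2 =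
        \sum_x (p i x * (loc x == u)%:R + (p i x * q i u ^+ 2 -
          2 * q i u * (p i x * (loc x == u)%:R))).
      by apply: eq_bigr => x _; case: (loc x == u); rewrite ?mulr1n ?mulr0n; ring.
    rewrite big_split sumrB /= -big_distrl -big_distrr /= p1 -/(q i u).
    have := sqr_ge0 (q i u); nra.
  move=> i; have [_ p1] := hp i.
  under eq_bigr do rewrite mulrBr.
  by rewrite sumrB -big_distrl /= p1 mul1r subrr.
rewrite exchange_big /= -[n in leRHS]card_ord -sum1_card natr_sum ler_sum // => i _.
rewrite exchange_big /=; have [_ p1] := hp i; rewrite -[leRHS]p1 ler_sum // => x _.
rewrite -big_distrr (bigD1 (loc x)) //= eqxx big1 ?addr0 ?mulr1 // => u.
by rewrite eq_sym => /negPf ->.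
Qed.

(** The mean term does not depend on [t], so it cancels between servers and requests. *)
Lemma count_mem_deviation u (t : n.-tuple T) :
  (count_mem u (map loc t))%:R = deviation u t + \sum_i q i u.
Proof.
rewrite /deviation sumrB subrK count_map -sum1_count big_mkcond big_tuple natr_sum.
by apply: eq_bigr => i _ /=; case: eqP.
Qed.

(** Servers and requests have equal mean counts in each cell, so any excess comes from two
    deviations, each of total variance at most n. *)
Lemma mean_excess_le : (0 < n)%N -> (0 < #|U|)%N ->
  \sum_(S : n.-tuple T) \sum_(Q : n.-tuple T)
      product_distribution p S * product_distribution p Q *
      \sum_u (count_mem u (map loc Q) - count_mem u (map loc S))%:R
    <= 5 / 2 * (Num.sqrt n%:R * Num.sqrt #|U|%:R) :> R.
Proof.
move=> n_gt0 U_gt0; set A := Num.sqrt n%:R; set B := Num.sqrt #|U|%:R.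
have A_gt0 : 0 < A by rewrite sqrtr_gt0 ltr0n.
have B_gt0 : 0 < B by rewrite sqrtr_gt0 ltr0n.
have A2 : A ^+ 2 = n%:R by rewrite sqr_sqrtr ?ler0n.
have B2 : B ^+ 2 = #|U|%:R by rewrite sqr_sqrtr ?ler0n.
pose W t := \sum_u deviation u t ^+ 2; pose P := product_distribution p.
(* AM-GM: 2 A B z <= A^2 + B^2 z^2 for each excess z, where the ratio A / B
   balances the two sums over U. *)
have pointwise (S Q : n.-tuple T) : 2 * (A * B) *
    (\sum_u (count_mem u (map loc Q) - count_mem u (map loc S))%:R) <=
    A ^+ 2 * B ^+ 2 + 2 * B ^+ 2 * (W Q + W S).
  have -> : A ^+ 2 * B ^+ 2 + 2 * B ^+ 2 * (W Q + W S) =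
      \sum_u (A ^+ 2 + 2 * B ^+ 2 * (deviation u Q ^+ 2 + deviation u S ^+ 2)).
    by rewrite big_split sumr_const -big_distrr big_split /= {1}B2 mulr_natr.
  rewrite big_distrr; apply: ler_sum => u _ /=.
  set z := (_ - _)%:R; set a := deviation u Q; set b := deviation u S.
  suff z2 : z ^+ 2 <= 2 * (a ^+ 2 + b ^+ 2).
    have := sqr_ge0 (A - B * z); have := ler_wpM2l (sqr_ge0 B) z2; nra.
  apply: (@le_trans _ _ ((a - b) ^+ 2)); last by have := sqr_ge0 (a + b); nra.
  have -> : a - b = (count_mem u (map loc Q))%:R - (count_mem u (map loc S))%:R.
    by rewrite !count_mem_deviation opprD addrACA subrr addr0.
  (* The truncated difference is either the true one or 0. *)
  rewrite /z; have [le_SQ|/ltnW/eqP ->] :=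
    leqP (count_mem u (map loc S)) (count_mem u (map loc Q)).
    by rewrite natrB.
  by rewrite expr0n sqr_ge0.
have sumP : \sum_t P t = 1 := sum_product_distribution hp.
have P_ge0 t : 0 <= P t := product_distribution_ge0 t hp.
have AB_gt0 : 0 < 2 * (A * B) by rewrite !mulr_gt0 ?ltr0n.
rewrite -(ler_pM2l AB_gt0) big_distrr /=.
apply: (@le_trans _ _ (\sum_S \sum_Q (P S * P Q * (A ^+ 2 * B ^+ 2) +
   2 * B ^+ 2 * (P S * (P Q * W Q) + P Q * (P S * W S))))).
  apply: ler_sum => S _; rewrite big_distrr /=; apply: ler_sum => Q _.
  rewrite mulrCA; have := ler_wpM2l (mulr_ge0 (P_ge0 S) (P_ge0 Q)) (pointwise S Q).
  move/le_trans; apply; rewrite le_eqVlt; apply/orP; left; apply/eqP; ring.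
have EW : \sum_t P t * W t <= n%:R := sum_variance_le.
have -> : \sum_S \sum_Q (P S * P Q * (A ^+ 2 * B ^+ 2) +
   2 * B ^+ 2 * (P S * (P Q * W Q) + P Q * (P S * W S))) =
   \sum_S (P S * (A ^+ 2 * B ^+ 2) + 2 * B ^+ 2 * (P S * (\sum_t P t * W t) + P S * W S)).
  apply: eq_bigr => S _; rewrite big_split -!big_distrl -!big_distrr big_split /=.
  by rewrite -!big_distrr -!big_distrl /= sumP mulr1 mul1r.
rewrite big_split -big_distrl -big_distrr big_split -big_distrl /= sumP !mul1r.
rewrite -A2 in EW.
(* The constant term gives A^2 B^2 and the two variances 4 A^2 B^2; dividing the total by 2 A B
   leaves 5/2 A B. *)
have := ler_wpM2l (sqr_ge0 B) EW; nra.
Qed.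

End ProductDistribution.

(* Both sides sum over 0 <= i <= k < h, with i = h - j - 1 and k = i + l. *)
Lemma geometric_reindex (R : rcfType) (h : nat) (alpha H : R) (s : nat -> R) :
  alpha != 0 ->
  \sum_(0 <= j < h) (s (h - j)%N / alpha ^+ (h - j - 1) *
     \sum_(0 <= l < j.+1) (H / alpha) ^+ l) =
  \sum_(k < h) \sum_(i < h | (i <= k)%N) alpha ^- k * H ^+ (k - i) * s i.+1.
Proof.
move=> a0; rewrite (exchange_big_dep predT) //= big_nat_rev big_mkord.
apply: eq_bigr => i _; have ih := ltn_ord i.
rewrite add0n subKn // subn1 /= subnSK //.
transitivity (\sum_(0 + i <= k < h) alpha ^- k * H ^+ (k - i) * s i.+1); last exact: big_geq_mkord.
rewrite big_addn big_distrr /=.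
apply: eq_bigr => l _.
rewrite addnK exprD exprMn exprVn; field.
by rewrite !expf_neq0.
Qed.

(** * Summation of the mean excess over all levels *)

Theorem theorem1 (R : rcfType) (Delta h n : nat) (alpha : R)
    (hDelta : (2 <= Delta)%N) (hh : (1 <= h)%N) (halpha : 2 <= alpha)
    (D : 'I_n -> h.-tuple 'I_Delta -> R)
    (hD : forall i : 'I_n, is_distribution (D i)) :
  let xi : R := harmonic R Delta / alpha in
  RS_expected_cost alpha D <=
    6 * harmonic R Delta * Num.sqrt n%:R *
      \sum_(0 <= j < h)
        (Num.sqrt ((Delta ^ (h - j))%N%:R) / alpha ^+ (h - j - 1) *
         \sum_(0 <= l < j.+1) xi ^+ l).
Proof.
cbv zeta; set H := harmonic R Delta.
have alpha_gt0 : 0 < alpha by lra.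
have H_ge0 : 0 <= H := harmonic_ge0 R Delta.
rewrite (geometric_reindex h H (fun m => Num.sqrt (Delta ^ m)%N%:R)) ?gt_eqF //.
(* [mean_excess_le] asks for n > 0; with no requests both sides are 0. *)
case: n D hD => [|n'] D hD.
  rewrite /RS_expected_cost big1 => [|S _]; first by rewrite sqrtr0 mulr0 mul0r.
  by rewrite big1 // => Q _; rewrite /RS_cost big1 ?mulr0 // => X _; rewrite big_ord0 mulr0.
set n := n'.+1; pose P := product_distribution D.
have P_ge0 t : 0 <= P t := product_distribution_ge0 t hD.
apply: (@le_trans _ _ (\sum_S \sum_Q P S * P Q *
   (2 * \sum_(k < h) \sum_(i < h | (i <= k)%N)
      alpha ^- k * H ^+ (k.+1 - i) * excess R i S Q))).
  apply: ler_sum => S _; apply: ler_sum => Q _.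
  by rewrite ler_wpM2l ?mulr_ge0 ?RS_cost_le_excess.
have -> : \sum_S \sum_Q P S * P Q *
     (2 * \sum_(k < h) \sum_(i < h | (i <= k)%N)
        alpha ^- k * H ^+ (k.+1 - i) * excess R i S Q) =
   2 * \sum_(k < h) \sum_(i < h | (i <= k)%N) alpha ^- k * H ^+ (k.+1 - i) *
     \sum_S \sum_Q P S * P Q * excess R i S Q.
  rewrite pair_big /=.
  under eq_bigr do rewrite mulrCA big_distrr.
  rewrite -big_distrr exchange_big /=; congr (_ * _); apply: eq_bigr => k _.
  under eq_bigr do rewrite big_distrr.
  rewrite exchange_big /=; apply: eq_bigr => i _.
  rewrite pair_big big_distrr /=; apply: eq_bigr => SQ _; ring.
apply: (@le_trans _ _ (2 * \sum_(k < h) \sum_(i < h | (i <= k)%N)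
    alpha ^- k * H ^+ (k.+1 - i) *
    (5 / 2 * (Num.sqrt n%:R * Num.sqrt (Delta ^ i.+1)%N%:R)))).
  rewrite ler_wpM2l ?ler0n //; apply: ler_sum => k _; apply: ler_sum => i _.
  rewrite ler_wpM2l ?mulr_ge0 ?invr_ge0 ?exprn_ge0 ?(ltW alpha_gt0) //.
  (* One cell per node of depth i + 1. *)
  have cardU : #|{: i.-tuple 'I_Delta * 'I_Delta}| = (Delta ^ i.+1)%N.
    by rewrite card_prod card_tuple card_ord -expnSr.
  rewrite -cardU; apply: mean_excess_le => //.
  by rewrite cardU expn_gt0; lia.
clearbody H; rewrite !big_distrr /=; apply: ler_sum => k _.
rewrite !big_distrr /=; apply: ler_sum => i ik.
rewrite subSn // exprS.
set s := Num.sqrt _; set t := Num.sqrt _.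
have X_ge0 : 0 <= H * s * (alpha ^- k * H ^+ (k - i) * t).
  by rewrite !mulr_ge0 ?sqrtr_ge0 ?exprn_ge0 ?invr_ge0 ?(ltW alpha_gt0) // exprn_ge0 // ltW.
(* The constant is 2 * 5/2 = 5, at most 6; one factor [H] of the power k + 1 - i becomes the
   prefactor. *)
apply: (@le_trans _ _ (5 * (H * s * (alpha ^- k * H ^+ (k - i) * t)))).
  by rewrite le_eqVlt; apply/orP; left; apply/eqP; field; rewrite ?expf_neq0 ?gt_eqF.
rewrite -!(mulrA 6); apply: ler_wpM2r => //.
by rewrite ler_nat.
Qed.
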